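(* Let $n \ge 1$ be an integer. (i) $\operatorname{ord}_2(\omega(n)) = d_2(n) - 1$. (ii) If $p$ is an odd prime, then $$\operatorname{ord}_p(\omega(n)) = \varepsilon(p)\cdot m - \frac{(n-d_p(n)) - (m-d_p(m))}{p-1},$$ where $v(p)$ is the Mersenne order at $p$, $m$ is the largest integer $\le (n-1)/v(p)$, and $\varepsilon(p)$ is the Wieferich exponent at $p$.
   Context: For $n \ge 1$ let $M_n = 2^n - 1$, let $F(n) = n!_M = \prod_{i=1}^n M_i$ (with $F(0)=1$), and let $\omega(n) = \frac{2^{n-1} F(n-1)}{n!} \in \mathbb{Q}$. For a prime $p$, $\operatorname{ord}_p$ denotes the $p$-adic valuation on $\mathbb{Q}^*$. For a prime $p$ and an integer $m \ge 0$ with $p$-adic expansion $m = \sum_{i=0}^r m_i p^i$, $m_i \in \{0,\dots,p-1\}$, $d_p(m) = \sum_{i=0}^r m_i$ is the digit sum (so $d_p(0)=0$). For an odd prime $p$, the Mersenne order $v(p)$ is the smallest integer $r \ge 1$ such that $p$ divides $M_r$, and the Wieferich exponent is $\varepsilon(p) = \operatorname{ord}_p(M_{v(p)})$. *)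

(* Defs.v *)
From mathcomp Require Import all_boot all_order all_algebra.
From mathcomp Require Import cyclic.

Set Implicit Arguments.
Unset Strict Implicit.
Unset Printing Implicit Defensive.

Import GRing.Theory.

Local Open Scope nat_scope.

Definition mersenne (n : nat) : nat := 2 ^ n - 1.

Definition mersenne_fact (n : nat) : nat := \prod_(1 <= i < n.+1) mersenne i.

(* Used only for n >= 1, so that n.-1 is the true n - 1. *)
Definition omega (n : nat) : rat :=
  ((2 ^ n.-1 * mersenne_fact n.-1)%:R / (n`!)%:R)%R.

(* p-adic valuation of a nonzero rational, for p prime; it takes the junk
   value 0 at x = 0. *)
Definition padic_ord (p : nat) (x : rat) : int :=
  ((logn p `|numq x|)%:Z - (logn p `|denq x|)%:Z)%R.

Definition digit (p m i : nat) : nat := m %/ p ^ i %% p.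

(* For p >= 2 we have m < p ^ m, so all nonzero digits of m have index <= m:
   see digit_expansion below. *)
Definition digit_sum (p m : nat) : nat := \sum_(i < m.+1) digit p m i.

Lemma digit_lt (p m i : nat) : 1 < p -> digit p m i < p.
Proof. by move=> p_gt1; rewrite ltn_mod ltnW. Qed.

Lemma digit_expansion (p m : nat) :
  1 < p -> m = \sum_(i < m.+1) digit p m i * p ^ i.
Proof.
move=> p_gt1.
have expand k : m = \sum_(i < k) digit p m i * p ^ i + m %/ p ^ k * p ^ k.
  elim: k => [|k {1}->]; first by rewrite big_ord0 expn0 divn1 muln1.
  rewrite big_ord_recr /= -addnA; congr (_ + _).
  rewrite {1}(divn_eq (m %/ p ^ k) p) -divnMA -expnSr mulnDl addnC.
  by rewrite -mulnA -expnS.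
rewrite {1}(expand m.+1) divn_small ?addn0 //.
exact: ltn_trans (ltnSn m) (ltn_expl _ p_gt1).
Qed.

Lemma mersenne_order_exists (p : nat) :
  odd p -> exists r, (0 < r) && (p %| mersenne r).
Proof.
move=> p_odd; exists (totient p).
rewrite totient_gt0 odd_gt0 //=.
have cop : coprime 2 p by rewrite coprime2n.
have := Euler_exp_totient cop; move/eqP.
by rewrite eqn_mod_dvd ?expn_gt0.
Qed.

Definition mersenne_order (p : nat) (p_odd : odd p) : nat :=
  ex_minn (mersenne_order_exists p_odd).

Definition wieferich_exponent (p : nat) (p_odd : odd p) : int :=
  padic_ord p (mersenne (mersenne_order p_odd))%:R%R.

(* Main.v *)
Require Import Defs.
From mathcomp Require Import all_boot all_order all_algebra.
From mathcomp Require Import ring zify.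

(** The valuation is additive, so [omega n], a quotient of two natural numbers,
    has order
      (n - 1) * ord_p 2 + ord_p (M_1 * ... * M_(n-1)) - ord_p n!.
    The factorial is handled by Legendre's formula
    (p - 1) * ord_p n! = n - d_p(n) ([legendre_digit_sum]).

    For p = 2 every M_i is odd, so only the power of 2 and n! contribute.

    For p odd, p divides M_i exactly when v = v(p) divides i
    ([dvdn_mersenne]), and lifting the exponent ([logn_pred_exp]), applied
    to a = 2 ^ v, gives ord_p M_(v j) = ord_p M_v + ord_p j.  Summing over the
    m multiples v, 2 v, ..., m v below n, the constant terms add up to
    epsilon(p) * m and the terms ord_p j add up to ord_p m!
    ([logn_mersenne_fact]).  A second use of Legendre's formula, for m!,
    finishes the computation. *)

Import GRing.Theory.

Local Open Scope nat_scope.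

(** * Legendre's formula *)

(** With q_i the quotient of n by p ^ i, the i-th digit is q_i - p * q_(i+1).
    Summing over i telescopes, since q_0 = n while q_1 + q_2 + ... is the
    exponent of p in n!. *)
Lemma legendre_digit_sum p n :
  prime p -> n + logn p n`! = digit_sum p n + p * logn p n`!.
Proof.
move=> p_pr; have p_gt1 := prime_gt1 p_pr.
have digitE i : n %/ p ^ i = digit p n i + p * (n %/ p ^ i.+1).
  rewrite /digit expnSr divnMA {1}(divn_eq (n %/ p ^ i) p).
  by rewrite addnC mulnC.
have lognE : logn p n`! = \sum_(i < n) n %/ p ^ i.+1.
  by rewrite logn_fact // big_add1 /= big_mkord.
have q_last : n %/ p ^ n.+1 = 0.
  by rewrite divn_small // (ltn_trans (ltnSn n)) // ltn_expl.
have -> : n + logn p n`! = \sum_(i < n.+1) n %/ p ^ i.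
  by rewrite big_ord_recl expn0 divn1 lognE.
rewrite (eq_bigr _ (fun (i : 'I_n.+1) _ => digitE i)) big_split /=.
by rewrite -big_distrr /= [X in p * X]big_ord_recr /= q_last addn0 lognE.
Qed.

(** * Lifting the exponent *)

(** Each a ^ i is 1 mod p, so the cofactor 1 + a + ... + a ^ (k - 1) of
    a ^ k - 1 is congruent to k, hence prime to p. *)
Lemma logn_pred_exp_coprime p a k :
  p %| a.-1 -> 0 < a -> coprime p k ->
  logn p (a ^ k).-1 = logn p a.-1.
Proof.
move=> p_dv a_gt0 cop_k.
have a_mod : a = 1 %[mod p].
  by apply/eqP; rewrite eqn_mod_dvd // subn1.
have sum_mod : \sum_(i < k) a ^ i = k %[mod p].
  rewrite -modn_summ (eq_bigr (fun=> 1 %% p)); last first.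
    by move=> i _; rewrite -modnXm a_mod modnXm exp1n.
  by rewrite modn_summ sum1_card card_ord.
rewrite predn_exp mulnC logn_Gauss //.
by rewrite -coprime_modr sum_mod coprime_modr.
Qed.

(** Modulo p ^ 2 the binomial expansion of a ^ i = (1 + c) ^ i stops at
    1 + i * c, so the cofactor 1 + a + ... + a ^ (p - 1) is congruent to
    p + c * 'C(p, 2).  For p odd the last term vanishes, which leaves exactly one
    factor p. *)
Lemma logn_pred_exp_prime p a :
  prime p -> odd p -> p %| a.-1 -> 1 < a ->
  logn p (a ^ p).-1 = (logn p a.-1).+1.
Proof.
move=> p_pr p_odd /dvdnP[b ab] a_gt1.
have p_gt0 := prime_gt0 p_pr.
have pow_mod i : a ^ i = 1 + i * a.-1 %[mod p ^ 2].
  elim: i => [|i IHi]; first by rewrite mul0n.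
  rewrite expnSr -modnMml IHi modnMml ab.
  have -> : a = 1 + b * p by lia.
  have -> : (1 + i * (b * p)) * (1 + b * p)
            = i * b ^ 2 * p ^ 2 + (1 + i.+1 * (b * p)) by ring.
  by rewrite modnMDl.
have sum_mod : \sum_(i < p) a ^ i = p %[mod p ^ 2].
  rewrite -modn_summ (eq_bigr _ (fun (i : 'I_p) _ => pow_mod i)) modn_summ.
  rewrite big_split /= sum1_card card_ord -big_distrl /=.
  have -> : \sum_(i < p) i = p * p.-1./2.
    by rewrite -(bin2odd p_odd) -bin2_sum big_mkord.
  have -> : p * p.-1./2 * a.-1 = p.-1./2 * b * p ^ 2 by rewrite ab; ring.
  by rewrite addnC modnMDl.
have sum_gt0 : 0 < \sum_(i < p) a ^ i.
  rewrite -(ltn_predK p_gt0) big_ord_recl expn0; lia.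
have logn_sum : logn p (\sum_(i < p) a ^ i) = 1.
  have dvE e : e <= 2 -> (e <= logn p (\sum_(i < p) a ^ i)) = (e <= 1).
    move=> e_le2; rewrite -pfactor_dvdn //.
    rewrite /dvdn -(modn_dvdm _ (dvdn_exp2l p e_le2)) sum_mod.
    rewrite (modn_dvdm _ (dvdn_exp2l p e_le2)) -/(_ %| _).
    by rewrite pfactor_dvdn // logn_prime // eqxx.
  by apply/eqP; rewrite eqn_leq leqNgt dvE // dvE.
by rewrite predn_exp lognM ?logn_sum ?addn1 //; lia.
Qed.

(** Split off the prime-to-p part of k, then add one factor p at a time. *)
Lemma logn_pred_exp p a k :
  prime p -> odd p -> p %| a.-1 -> 1 < a -> 0 < k ->
  logn p (a ^ k).-1 = logn p a.-1 + logn p k.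
Proof.
move=> p_pr p_odd p_dv a_gt1 k_gt0.
have [k' cop_k' kE] := pfactor_coprime p_pr k_gt0.
rewrite {1}kE; move: (logn p k) => e; clear kE.
have k'_gt0 : 0 < k'.
  by case: k' cop_k' => //; rewrite /coprime gcdn0 => /eqP p1; rewrite p1 in p_pr.
elim: e => [|e IHe].
  by rewrite muln1 addn0 logn_pred_exp_coprime // ltnW.
rewrite expnSr mulnA expnM logn_pred_exp_prime // ?IHe ?addnS //.
  by rewrite predn_exp dvdn_mulr.
by rewrite -(exp1n (k' * p ^ e)) ltn_exp2r // muln_gt0 k'_gt0 expn_gt0 prime_gt0.
Qed.

(** * Mersenne numbers *)

Lemma mersenne_gt0 i : 0 < i -> 0 < mersenne i.
Proof. by case: i => // i _; rewrite /mersenne subn_gt0 -{1}(expn0 2) ltn_exp2l. Qed.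

Lemma mersenne_fact_gt0 n : 0 < mersenne_fact n.
Proof.
rewrite /mersenne_fact big_add1 /= prodn_gt0 // => i.
exact: mersenne_gt0.
Qed.

Lemma mersenne_factS n :
  mersenne_fact n.+1 = mersenne_fact n * mersenne n.+1.
Proof. by rewrite /mersenne_fact big_nat_recr. Qed.

Lemma odd_mersenne_fact n : odd (mersenne_fact n).
Proof.
elim: n => [|n IHn]; first by rewrite /mersenne_fact big_geq.
rewrite mersenne_factS oddM IHn /mersenne oddB ?expn_gt0 //.
by rewrite oddX.
Qed.

Lemma dvdn_mersenneE d i : (d %| mersenne i) = (2 ^ i == 1 %[mod d]).
Proof. by rewrite eqn_mod_dvd ?expn_gt0. Qed.

Section OddPrime.

Variables (p : nat) (p_prime : prime p) (p_odd : odd p).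
Let v := mersenne_order p_odd.

Lemma mersenne_orderP :
  [/\ 0 < v, p %| mersenne v &
      forall r, 0 < r -> p %| mersenne r -> v <= r].
Proof.
rewrite /v /mersenne_order; case: ex_minnP => r /andP[r_gt0 p_dv] r_min.
by split=> // s s_gt0 s_dv; apply: r_min; rewrite s_gt0.
Qed.

(** Reducing i modulo v does not change 2 ^ i modulo p, and by minimality of v
    no remainder other than 0 gives 1. *)
Lemma dvdn_mersenne i : (p %| mersenne i) = (v %| i).
Proof.
have [v_gt0 v_dv v_min] := mersenne_orderP.
have v_mod : 2 ^ v = 1 %[mod p] by apply/eqP; rewrite -dvdn_mersenneE.
have red : 2 ^ i = 2 ^ (i %% v) %[mod p].
  rewrite {1}(divn_eq i v) expnD mulnC [i %/ v * v]mulnC expnM -modnMmr.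
  by rewrite -modnXm v_mod modnXm exp1n modnMmr muln1.
rewrite dvdn_mersenneE red -dvdn_mersenneE /dvdn -/(_ %| _).
apply/idP/eqP => [r_dv | ->]; last by rewrite /mersenne expn0 subnn dvdn0.
apply/eqP; rewrite -leqn0 leqNgt; apply/negP => r_gt0.
by have := v_min _ r_gt0 r_dv; rewrite leqNgt ltn_mod v_gt0.
Qed.

Lemma logn_mersenne_mul j :
  0 < j -> logn p (mersenne (v * j)) = logn p (mersenne v) + logn p j.
Proof.
have [v_gt0 v_dv _] := mersenne_orderP.
move=> j_gt0; rewrite /mersenne !subn1 expnM logn_pred_exp //.
  by rewrite -subn1.
by rewrite -{1}(expn0 2) ltn_exp2l.
Qed.

Lemma logn_mersenne_fact n :
  logn p (mersenne_fact n)
    = logn p (mersenne v) * (n %/ v) + logn p (n %/ v)`!.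
Proof.
have [v_gt0 _ _] := mersenne_orderP.
elim: n => [|n IHn]; first by rewrite /mersenne_fact big_geq // div0n muln0 !logn1.
rewrite mersenne_factS lognM ?mersenne_fact_gt0 ?mersenne_gt0 // IHn divnS //.
case: (boolP (v %| n.+1)) => [v_dv | v_ndv] /=; last first.
  have : logn p (mersenne n.+1) = 0.
    by rewrite logn_coprime // prime_coprime // dvdn_mersenne.
  by move=> ->; rewrite add0n addn0.
have nE : n.+1 = v * (n %/ v).+1.
  by rewrite mulnC -{1}(divnK v_dv) divnS // v_dv.
rewrite nE logn_mersenne_mul // add1n factS lognM ?fact_gt0 //.
by rewrite mulnS; ring.
Qed.

End OddPrime.

(** * Valuations of rationals *)

(** The valuation is computed from the reduced fraction of a / b;
    cross-multiplying compares it with a and b. *)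
Lemma padic_ord_div p a b :
  0 < a -> 0 < b ->
  (padic_ord p (a%:R / b%:R) = (logn p a)%:Z - (logn p b)%:Z)%R.
Proof.
move=> a_gt0 b_gt0; set x := (a%:R / b%:R)%R.
have a_neq0 : (a%:R != 0 :> rat)%R by rewrite Num.Theory.pnatr_eq0 -lt0n.
have b_neq0 : (b%:R != 0 :> rat)%R by rewrite Num.Theory.pnatr_eq0 -lt0n.
have x_neq0 : (x != 0)%R by rewrite mulf_neq0 ?invr_eq0.
have cross : (numq x * b%:Z = a%:Z * denq x)%R.
  apply: (@intr_inj rat); rewrite !rmorphM /= -!pmulrn.
  by rewrite numqE [RHS]mulrC -(divfK b_neq0 a%:R%R) -/x; ring.
have /(congr1 (fun z : int => logn p `|z|)) := cross.
rewrite !abszM !absz_nat !lognM ?absz_gt0 ?numq_eq0 ?denq_neq0 //.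
rewrite /padic_ord; lia.
Qed.

Lemma padic_ord_nat p a : 0 < a -> (padic_ord p a%:R = (logn p a)%:Z)%R.
Proof.
by move=> a_gt0; have := padic_ord_div p a 1 a_gt0 isT; rewrite divr1 logn1 subr0.
Qed.

Lemma padic_ord_omega p n :
  (padic_ord p (omega n)
   = (n.-1 * logn p 2 + logn p (mersenne_fact n.-1))%:Z - (logn p n`!)%:Z)%R.
Proof.
rewrite /omega padic_ord_div ?fact_gt0 ?muln_gt0 ?expn_gt0 ?mersenne_fact_gt0 //.
by rewrite lognM ?lognX ?expn_gt0 ?mersenne_fact_gt0.
Qed.

Theorem proposition2p1 (n : nat) (n_gt0 : (0 < n)%N) :
  (padic_ord 2 (omega n) = (digit_sum 2 n)%:Z - 1)%R /\
  (forall (p : nat) (p_prime : prime p) (p_odd : odd p),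
     let m := (n.-1 %/ mersenne_order p_odd)%N in
     ((padic_ord p (omega n))%:~R =
        (wieferich_exponent p_odd)%:~R * m%:R
        - ((n%:R - (digit_sum p n)%:R) - (m%:R - (digit_sum p m)%:R))
          / (p%:R - 1) :> rat)%R).
Proof.
split=> [|p p_prime p_odd m].
  have legendre := legendre_digit_sum 2 n isT.
  rewrite padic_ord_omega (@logn_coprime 2 (mersenne_fact _)); last first.
    by rewrite coprime2n odd_mersenne_fact.
  rewrite (logn_prime 2) //= muln1 addn0; lia.
have [v_gt0 _ _] := mersenne_orderP p p_odd.
rewrite padic_ord_omega /wieferich_exponent padic_ord_nat ?mersenne_gt0 //.
have logn2 : logn p 2 = 0.
  by rewrite logn_coprime // coprime_sym coprime2n.
rewrite logn2 muln0 add0n (logn_mersenne_fact p p_prime p_odd) -/m.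
have p1_neq0 : (p%:R - 1 != 0 :> rat)%R.
  by rewrite subr_eq0 Num.Theory.pnatr_eq1 gtn_eqF ?prime_gt1.
have legendreQ k : (k%:R - (digit_sum p k)%:R
                    = (p%:R - 1) * (logn p k`!)%:R :> rat)%R.
  have /(congr1 (fun i => i%:R : rat)%R) := legendre_digit_sum p k p_prime.
  rewrite !natrD natrM => legendre.
  by rewrite mulrBl mul1r -[(p%:R * _)%R](addKr (digit_sum p k)%:R%R) -legendre; ring.
rewrite !legendreQ -mulrBr [(_ / _)%R]mulrC mulKf // rmorphB /= -!pmulrn natrD natrM.
by ring.
Qed.
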